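(* Let $f\colon\mathbb{Z}_2\to\mathbb{Z}_2$ be a compatible and ergodic map, let $z\in\mathbb{Z}_2$, let $n\ge 1$ be an integer, let $\mathcal{T}_n=\{z_i=f^i(z)\bmod 2^n\}_{i=0}^{\infty}$, and let $\mathcal{T}'_n$ be the binary representation of $\mathcal{T}_n$, i.e. the binary sequence obtained by concatenating the $n$-bit words $\delta_0(z_i)\delta_1(z_i)\dots\delta_{n-1}(z_i)$ for $i=0,1,2,\dots$. Then $\mathcal{T}'_n$ is a purely periodic binary sequence of period length exactly $n2^n$, it is strictly $n$-distributed, and it satisfies property Q1.
   Context: $\mathbb{Z}_2$ is the ring of $2$-adic integers; $\delta_j(x)\in\{0,1\}$ is the $j$-th binary digit of $x$, $x=\sum_{j\ge0}\delta_j(x)2^j$; $x\bmod 2^n=\sum_{j<n}\delta_j(x)2^j$; $f^i$ is the $i$-fold iterate of $f$ ($f^0(z)=z$). Binary words are written with the least significant digit first (left to right). A map $f\colon\mathbb{Z}_2\to\mathbb{Z}_2$ is compatible if $u\equiv v\pmod{2^r}$ implies $f(u)\equiv f(v)\pmod{2^r}$ for all $u,v\in\mathbb{Z}_2$, $r\ge1$. Ergodic means: measure preserving with respect to the normalized Haar measure $\mu$ on $\mathbb{Z}_2$, and every measurable $S$ with $f^{-1}(S)=S$ has $\mu(S)\in\{0,1\}$. Strict $k$-distribution: let $\mathcal{S}=s_0s_1s_2\dots$ be a purely periodic binary sequence with period length exactly $N$, and consider the cyclic word (the $N$-cycle) $C(\mathcal{S})=(s_0s_1\dots s_{N-1})$.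 For $k<N$, an occurrence of a binary word $\beta_0\dots\beta_{k-1}$ in $C(\mathcal{S})$ is an index $j\in\{0,\dots,N-1\}$ with $\beta_i=s_{(i+j)\bmod N}$ for $i=0,\dots,k-1$. The cycle is $k$-full if there is $r>0$ such that each of the $2^k$ binary words of length $k$ occurs in it exactly $r$ times; $\mathcal{S}$ is strictly $k$-distributed if $C(\mathcal{S})$ is $k$-full. Property Q1: a finite binary sequence $\varepsilon_0\varepsilon_1\dots\varepsilon_{N-1}$ of length $N$ satisfies Q1 if $$\left|\frac{\nu(\beta_0\dots\beta_{k-1})}{N}-\frac{1}{2^k}\right|\le\frac{1}{\sqrt N}$$ for all integers $k$ with $0<k\le\log_2 N$ and all binary words $\beta_0\dots\beta_{k-1}$ of length $k$, where $\nu(\beta_0\dots\beta_{k-1})$ is the number of (possibly overlapping, non-cyclic) occurrences of $\beta_0\dots\beta_{k-1}$ as a block of consecutive letters in the word $\varepsilon_0\dots\varepsilon_{N-1}$. An infinite purely periodic binary sequence with period length exactly $N$ satisfies Q1 if the finite word consisting of its first $N$ terms does. *)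

(* Defs.v *)
From HB Require Import structures.
From mathcomp Require Import all_boot all_order all_algebra.
From mathcomp Require Import all_classical all_reals all_analysis.

Set Implicit Arguments.
Unset Strict Implicit.
Unset Printing Implicit Defensive.

Import Order.TTheory GRing.Theory Num.Theory.
Local Open Scope classical_set_scope.
Local Open Scope ring_scope.

(** * The ring of 2-adic integers *)

Record Z2 := MkZ2 { digit : nat -> bool }.

(* The integer [x mod 2^n], i.e. the sum of digit x j * 2^j for j < n. *)
Definition trunc (n : nat) (x : Z2) : nat := (\sum_(j < n) digit x j * 2 ^ j)%N.

Definition bit (m j : nat) : bool := odd (m %/ 2 ^ j)%N.

Definition eqmod (r : nat) (u v : Z2) : Prop := trunc r u = trunc r v.

HB.instance Definition _ := gen_eqMixin Z2.
HB.instance Definition _ := gen_choiceMixin Z2.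

Lemma truncS n x : trunc n.+1 x = (trunc n x + digit x n * 2 ^ n)%N.
Proof. by rewrite /trunc big_ord_recr. Qed.

Lemma trunc_lt n x : (trunc n x < 2 ^ n)%N.
Proof.
elim: n => [|n IHn]; first by rewrite /trunc big_ord0.
rewrite truncS expnS mul2n -addnn -addSn leq_add //.
by case: (digit x n); rewrite ?mul1n ?mul0n.
Qed.

Lemma trunc_inj x y : (forall n, trunc n x = trunc n y) -> x = y.
Proof.
case: x y => [a] [b] eq_ab; congr MkZ2; apply/funext => n.
have := eq_ab n.+1; rewrite !truncS eq_ab => /addnI /eqP.
by rewrite eqn_pmul2r ?expn_gt0 //=; case: (a n) (b n) => [] [].
Qed.

Lemma modn_exp2S m n : (m %% 2 ^ n.+1 = m %% 2 ^ n + bit m n * 2 ^ n)%N.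
Proof.
have def_m : m =
    ((m %/ 2 ^ n)./2 * 2 ^ n.+1 + (m %% 2 ^ n + bit m n * 2 ^ n))%N.
  rewrite {1}(divn_eq m (2 ^ n)) -{1}(odd_double_half (m %/ 2 ^ n)) /bit.
  by rewrite mulnDl -mul2n (mulnC 2%N) -mulnA -expnS -addnA addnC -addnA.
rewrite {1}def_m modnMDl modn_small //.
rewrite expnS mul2n -addnn -addSn leq_add ?ltn_mod ?expn_gt0 //.
by case: (bit m n); rewrite ?mul1n ?mul0n.
Qed.

Lemma trunc_mod m n x : (m <= n)%N -> (trunc n x %% 2 ^ m = trunc m x)%N.
Proof.
elim: n => [|n IHn]; first by rewrite leqn0 => /eqP->; rewrite modn_small ?trunc_lt.
rewrite leq_eqVlt => /orP[/eqP->|]; first by rewrite modn_small ?trunc_lt.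
rewrite ltnS => le_mn; rewrite truncS -(subnK le_mn) expnD mulnA addnC modnMDl.
by rewrite subnK // IHn.
Qed.

(* The 2-adic integer congruent to [g n] mod 2^n for all n, when such an
   integer exists. *)
Definition of_residues (g : nat -> nat) : Z2 := MkZ2 (fun j => bit (g j.+1) j).

Lemma trunc_of_residues g n :
    (forall i, g i.+1 = g i %[mod 2 ^ i])%N ->
  trunc n (of_residues g) = (g n %% 2 ^ n)%N.
Proof.
move=> coh; elim: n => [|n IHn]; first by rewrite /trunc big_ord0 modn1.
by rewrite truncS IHn modn_exp2S coh.
Qed.

Definition Z2_zero := MkZ2 (fun=> false).
Definition Z2_one := MkZ2 (fun j => j == 0%N).
Definition Z2_opp x := of_residues (fun n => 2 ^ n - trunc n x)%N.
Definition Z2_add x y := of_residues (fun n => trunc n x + trunc n y)%N.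
Definition Z2_mul x y := of_residues (fun n => trunc n x * trunc n y)%N.

Lemma trunc_zero n : trunc n Z2_zero = 0%N.
Proof. by rewrite /trunc big1. Qed.

Lemma trunc_one n : trunc n Z2_one = (1 %% 2 ^ n)%N.
Proof.
case: n => [|n]; first by rewrite /trunc big_ord0 modn1.
by rewrite /trunc big_ord_recl /= big1 // modn_small // -{1}(expn0 2) ltn_exp2l.
Qed.

Lemma trunc_opp n x : trunc n (Z2_opp x) = ((2 ^ n - trunc n x) %% 2 ^ n)%N.
Proof.
apply: trunc_of_residues => {n} i; apply/eqP.
rewrite -(eqn_modDr (trunc i.+1 x)) subnK ?(ltnW (trunc_lt _ _)) //.
rewrite -modnDmr trunc_mod // subnK ?(ltnW (trunc_lt _ _)) //.
by rewrite modnn expnS modnMl.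
Qed.

Lemma trunc_add n x y :
  trunc n (Z2_add x y) = ((trunc n x + trunc n y) %% 2 ^ n)%N.
Proof.
by apply: trunc_of_residues => i; rewrite -modnDm !trunc_mod.
Qed.

Lemma trunc_mul n x y :
  trunc n (Z2_mul x y) = ((trunc n x * trunc n y) %% 2 ^ n)%N.
Proof.
by apply: trunc_of_residues => i; rewrite -modnMm !trunc_mod.
Qed.

Lemma Z2_addA : associative Z2_add.
Proof.
move=> x y z; apply: trunc_inj => n.
by rewrite !trunc_add modnDmr modnDml addnA.
Qed.

Lemma Z2_addC : commutative Z2_add.
Proof. by move=> x y; apply: trunc_inj => n; rewrite !trunc_add addnC. Qed.

Lemma Z2_add0 : left_id Z2_zero Z2_add.
Proof.
by move=> x; apply: trunc_inj => n; rewrite trunc_add trunc_zero modn_small ?trunc_lt.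
Qed.

Lemma Z2_addN : left_inverse Z2_zero Z2_opp Z2_add.
Proof.
move=> x; apply: trunc_inj => n.
by rewrite trunc_add trunc_opp trunc_zero modnDml subnK ?modnn ?(ltnW (trunc_lt _ _)).
Qed.

HB.instance Definition _ :=
  GRing.isZmodule.Build Z2 Z2_addA Z2_addC Z2_add0 Z2_addN.

Lemma Z2_mulA : associative Z2_mul.
Proof.
move=> x y z; apply: trunc_inj => n.
by rewrite !trunc_mul modnMmr modnMml mulnA.
Qed.

Lemma Z2_mulC : commutative Z2_mul.
Proof. by move=> x y; apply: trunc_inj => n; rewrite !trunc_mul mulnC. Qed.

Lemma Z2_mul1 : left_id Z2_one Z2_mul.
Proof.
move=> x; apply: trunc_inj => n.
by rewrite trunc_mul trunc_one modnMml mul1n modn_small ?trunc_lt.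
Qed.

Lemma Z2_mulD : left_distributive Z2_mul Z2_add.
Proof.
move=> x y z; apply: trunc_inj => n.
by rewrite !(trunc_add, trunc_mul) modnMml modnDm mulnDl.
Qed.

Lemma Z2_one_neq0 : Z2_one != 0 :> Z2.
Proof.
by apply/eqP => /(congr1 (trunc 1)); rewrite trunc_one trunc_zero.
Qed.

HB.instance Definition _ := GRing.Zmodule_isComNzRing.Build Z2
  Z2_mulA Z2_mulC Z2_mul1 Z2_mulD Z2_one_neq0.

Lemma trunc_nat n m : trunc n (m%:R : Z2) = (m %% 2 ^ n)%N.
Proof.
elim: m => [|m IHm]; first by rewrite trunc_zero mod0n.
by rewrite -add1n natrD trunc_add IHm trunc_one modnDm.
Qed.

Lemma eqmodP r u v : eqmod r u v <-> exists w, u = v + 2 ^+ r * w.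
Proof.
rewrite -natrX; split=> [eq_uv|[w ->]]; last first.
  rewrite /eqmod trunc_add trunc_mul trunc_nat modnn mul0n mod0n addn0.
  by rewrite modn_small ?trunc_lt.
exists (MkZ2 (fun j => digit (u - v) (r + j))).
rewrite addrC; apply/eqP; rewrite -subr_eq; apply/eqP.
have: trunc r (u - v) = 0%N.
  rewrite trunc_add trunc_opp eq_uv modnDmr subnKC ?modnn //.
  exact: ltnW (trunc_lt _ _).
move: (u - v) => d d0; apply: trunc_inj => n.
rewrite trunc_mul trunc_nat modnMml.
have split_d k : trunc (r + k) d =
    (2 ^ r * trunc k (MkZ2 (fun j => digit d (r + j))))%N.
  elim: k => [|k IHk]; first by rewrite addn0 d0 /trunc big_ord0 muln0.
  by rewrite addnS !truncS IHk mulnDr mulnCA -expnD.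
by rewrite -split_d trunc_mod // leq_addl.
Qed.

(** * The 2-adic topology and its Borel sets *)

Definition Z2_open (U : set Z2) :=
  forall x, U x -> exists r : nat, [set y | eqmod r x y] `<=` U.

Lemma Z2_openT : Z2_open setT.
Proof. by move=> x _; exists 0%N. Qed.

Lemma Z2_openI : setI_closed Z2_open.
Proof.
move=> U V oU oV x [/oU[r rU] /oV[s sV]]; exists (maxn r s) => y /= xy.
by split; [apply: rU|apply: sV]; rewrite /= /eqmod;
  rewrite -(trunc_mod x (leq_maxl r s)) -(trunc_mod y (leq_maxl r s)) xy ||
  rewrite -(trunc_mod x (leq_maxr r s)) -(trunc_mod y (leq_maxr r s)) xy.
Qed.

Lemma Z2_open_bigU (I : Type) (F : I -> set Z2) :
  (forall i, Z2_open (F i)) -> Z2_open (\bigcup_i F i).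
Proof.
move=> oF x [i _ Fx]; have [r rF] := oF i x Fx.
by exists r => y /rF; exists i.
Qed.

HB.instance Definition _ :=
  isOpenTopological.Build Z2 Z2_openT Z2_openI Z2_open_bigU.

Lemma Z2_openE (U : set Z2) : open U = Z2_open U.
Proof. by []. Qed.

HB.instance Definition _ := isPointed.Build Z2 0.
HB.instance Definition _ := Measurable.copy Z2 (g_sigma_algebraType (@open Z2)).

(** * Haar measure, compatible and ergodic maps *)

(* A probability is the normalized Haar measure iff it is translation
   invariant. *)
Definition is_haar (R : realType) (mu : probability Z2 R) : Prop :=
  forall (a : Z2) (A : set Z2), measurable A ->
    mu [set a + x | x in A] = mu A.

Definition compatible (f : Z2 -> Z2) : Prop :=
  forall (r : nat) (u v : Z2), (1 <= r)%N -> eqmod r u v -> eqmod r (f u) (f v).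

Definition measure_preserving (R : realType) (mu : probability Z2 R)
    (f : Z2 -> Z2) : Prop :=
  measurable_fun setT f /\
  forall A : set Z2, measurable A -> mu (f @^-1` A) = mu A.

Definition ergodic (R : realType) (mu : probability Z2 R)
    (f : Z2 -> Z2) : Prop :=
  measure_preserving mu f /\
  forall S : set Z2, measurable S -> f @^-1` S = S ->
    mu S = 0%E \/ mu S = 1%E.

(** * Periodic binary sequences *)

Definition pure_period (T : Type) (s : nat -> T) (p : nat) : Prop :=
  (0 < p)%N /\ forall i, s (i + p)%N = s i.

Definition exact_period (T : Type) (s : nat -> T) (N : nat) : Prop :=
  pure_period s N /\ forall p, pure_period s p -> (N <= p)%N.

(* Occurrences of b in the cycle C, i.e. wrapping around the end of C. *)
Definition cyc_occ (C : seq bool) (k : nat) (b : k.-tuple bool) : nat :=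
  #|[pred j : 'I_(size C) |
     [forall i : 'I_k, tnth b i == nth false C ((i + j) %% size C)%N]]|.

Definition k_full (C : seq bool) (k : nat) : Prop :=
  (k < size C)%N /\
  exists2 r : nat, (0 < r)%N & forall b : k.-tuple bool, cyc_occ C b = r.

Definition strictly_distributed (k : nat) (s : nat -> bool) : Prop :=
  exists2 N, exact_period s N & k_full (mkseq s N) k.

(* Occurrences of b as a factor of the finite word e, without wrapping. *)
Definition word_occ (e : seq bool) (k : nat) (b : k.-tuple bool) : nat :=
  #|[pred j : 'I_(size e) | (j + k <= size e)%N &&
     [forall i : 'I_k, tnth b i == nth false e (j + i)%N]]|.

Definition Q1_word (R : realType) (e : seq bool) : Prop :=
  forall (k : nat) (b : k.-tuple bool),
    (0 < k)%N -> k%:R <= ln (size e)%:R / ln 2 :> R ->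
    `| (word_occ e b)%:R / (size e)%:R - 1 / 2 ^+ k |
      <= 1 / Num.sqrt (size e)%:R :> R.

Definition Q1 (R : realType) (s : nat -> bool) : Prop :=
  exists2 N, exact_period s N & Q1_word R (mkseq s N).

(** * The generated sequences *)

Definition orbit_mod (f : Z2 -> Z2) (z : Z2) (n i : nat) : nat :=
  trunc n (iter i f z).

(* Concatenation of the n-bit words of t 0, t 1, ...: the letter of index m
   is the bit m %% n of t (m %/ n). *)
Definition binary_repr (n : nat) (t : nat -> nat) : nat -> bool :=
  fun m => bit (t (m %/ n)%N) (m %% n)%N.

(* Main.v *)
Require Import Defs.
From mathcomp Require Import all_boot all_order all_algebra.
From mathcomp Require Import all_classical all_reals all_analysis.

Set Implicit Arguments.
Unset Strict Implicit.
Unset Printing Implicit Defensive.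

Import Order.TTheory GRing.Theory Num.Theory.

(** A compatible map [f] acts on the residues modulo [2 ^ r] for every [r], and
    each residue class has positive Haar measure. Measure preservation makes this
    action a permutation; the union of the classes in one of its cycles is an
    [f]-invariant set of positive measure, so ergodicity leaves room for only one
    cycle ([ergodic_single_cycles]). Thus [f^p z] and [f^q z] agree modulo
    [2 ^ r] exactly when [p] and [q] do.

    Write the orbit modulo [2 ^ n] as a bit stream. A window of length [n] that
    starts at offset [s] of the block of [f^p z] shows the bits [s .. n - 1] of
    [f^p z] and the [s] low bits of [f^(p+1) z]. The latter determine [p + 1],
    hence [p], modulo [2 ^ s], hence the [s] low bits of [f^p z]; so the window
    and its offset determine [p] modulo [2 ^ n] ([window_inj]). There are
    [n * 2 ^ n] positions in a cycle and as many pairs of an offset and a word,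
    so each word of length [n] occurs exactly once at each offset, [n] times in
    all ([card_window]): this is strict [n]-distribution.

    The period is exactly [n * 2 ^ n] because a period that is not a multiple of
    [n] would carry bit [0] of the orbit, which alternates, to some bit [s > 0],
    which does not ([exact_period_bit_stream]).

    Finally, a word of length [k <= n] occurs exactly [n * 2 ^ (n - k)] times in
    the cycle, at most [k] of them wrapping around, and a longer word occurs at
    most [n] times. In both cases its frequency is within [1 / 2 ^ n] of
    [1 / 2 ^ k] ([word_frequency]), and [1 / 2 ^ n] is at most the inverse square
    root of [n * 2 ^ n] since [n <= 2 ^ n]. *)

(** * Residues of 2-adic integers *)

Lemma trunc_eqP n x y :
  trunc n x = trunc n y <-> forall i, i < n -> digit x i = digit y i.
Proof.
elim: n => [|n IHn]; first by split=> // _; rewrite /trunc !big_ord0.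
split=> [eq_xy|eq_xy].
  have eq_n : trunc n x = trunc n y.
    by rewrite -(trunc_mod x (leqnSn n)) eq_xy trunc_mod.
  move=> i; rewrite ltnS leq_eqVlt => /orP[/eqP->|]; last first.
    by move/IHn: eq_n; apply.
  move: eq_xy; rewrite !truncS eq_n => /addnI/eqP.
  by rewrite eqn_pmul2r ?expn_gt0 //; case: (digit x n) (digit y n) => [] [].
by rewrite !truncS eq_xy // (IHn.2 _) // => i /ltnW lt_in; apply: eq_xy.
Qed.

Lemma bit_trunc n x i : i < n -> bit (trunc n x) i = digit x i.
Proof.
move=> lt_in; have := modn_exp2S (trunc n x) i.
rewrite !trunc_mod ?(ltnW lt_in) // truncS => /addnI/eqP.
by rewrite eqn_pmul2r ?expn_gt0 //; case: (digit x i) (bit _ i) => [] [].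
Qed.

Lemma measurable_residue r (P : pred nat) :
  measurable [set x : Z2 | P (trunc r x)]%classic.
Proof.
apply: sub_sigma_algebra; rewrite Z2_openE => x Px; exists r => y /= <-.
exact: Px.
Qed.

Lemma residue_class_translate r m : m < 2 ^ r ->
  [set (m%:R + x)%R | x in [set x : Z2 | trunc r x == 0]]%classic
  = [set x | trunc r x == m]%classic.
Proof.
move=> lt_m; apply/seteqP; split=> [_ [x /= /eqP x0 <-]|y /= /eqP ym].
  by rewrite trunc_add trunc_nat x0 addn0 !modn_small.
have /Defs.eqmodP[w ->] : eqmod r y (m%:R : Z2)%R.
  by rewrite /eqmod trunc_nat modn_small.
have : eqmod r (2 ^+ r * w)%R 0%R.
  by apply/Defs.eqmodP; exists w; rewrite add0r.
by rewrite /eqmod trunc_zero => w0; exists (2 ^+ r * w)%R => //=; apply/eqP.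
Qed.

(** By translation invariance one null class would make all [2 ^ r] of them
    null, and they cover the whole space. *)
Lemma residue_class_neq0 (R : realType) (mu : probability Z2 R) r m :
  is_haar mu -> m < 2 ^ r ->
  mu [set x : Z2 | trunc r x == m]%classic <> 0%E.
Proof.
move=> haar_mu lt_m mu_m0.
pose A j : set Z2 := [set x | trunc r x == j]%classic.
have mA j : measurable (A j) by apply: (@measurable_residue r (pred1 j)).
have muA j : j < 2 ^ r -> mu (A j) = 0%E.
  move=> lt_j; rewrite -mu_m0 /A -(residue_class_translate lt_j).
  by rewrite -(residue_class_translate lt_m) !haar_mu //; apply: (mA 0).
have := Boole_inequality mu (A := A) (n := 2 ^ r) (fun j _ => mA j).
rewrite (_ : \big[setU/set0]_(i < 2 ^ r) A i = setT)%classic; last first.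
  apply/seteqP; split=> // x _; rewrite -bigcup_mkord.
  by exists (trunc r x); rewrite //= ?trunc_lt /A /=.
rewrite [X in (X <= _)%E](probability_setT mu) big1 => [|j _]; last exact: muA.
by rewrite lee_fin ler10.
Qed.

(** * An ergodic compatible map permutes residues in a single cycle *)

Definition residue_map (f : Z2 -> Z2) r (m : 'I_(2 ^ r)) : 'I_(2 ^ r) :=
  Ordinal (trunc_lt r (f (m : nat)%:R%R)).

Definition residue r x : 'I_(2 ^ r) := Ordinal (trunc_lt r x).

Lemma residue_mapE f r x : compatible f ->
  residue_map f (residue r x) = residue r (f x).
Proof.
move=> cf; apply: val_inj => /=.
case: r => [|r]; first by rewrite /trunc !big_ord0.
by apply: cf => //; rewrite /eqmod trunc_nat modn_small ?trunc_lt.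
Qed.

(** The preimage of a residue class has the same, hence positive, measure, so
    it is inhabited: the induced map is onto a finite set of residues. *)
Lemma residue_map_inj (R : realType) (mu : probability Z2 R) f r :
  is_haar mu -> compatible f -> measure_preserving mu f ->
  injective (@residue_map f r).
Proof.
move=> haar_mu cf [_ mp].
suff onto m : m \in codom (@residue_map f r).
  suff /image_injP inj_f : #|codom (@residue_map f r)| == #|'I_(2 ^ r)|.
    by move=> x y; apply: inj_f.
  by apply/eqP/eq_card => m; rewrite [LHS]onto.
have mM := @measurable_residue r (pred1 (val m)).
have := @residue_class_neq0 R mu r m haar_mu (ltn_ord m).
rewrite -mp //; set B := (_ @^-1` _)%classic => B_neq0.
have [B0|/set0P[x Bx]] := eqVneq B set0.
  by case: B_neq0; rewrite B0 measure0.
apply/codomP; exists (residue r x); rewrite residue_mapE //.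
by apply: val_inj; move/eqP: Bx.
Qed.

(** The union of the residue classes in one cycle of the induced permutation
    is invariant and not null, so its complement is null and contains no
    residue class. *)
Lemma residue_map_connect (R : realType) (mu : probability Z2 R) f r :
  is_haar mu -> compatible f -> ergodic mu f ->
  forall m p, fconnect (@residue_map f r) m p.
Proof.
move=> haar_mu cf [mp erg] m p.
have inj_f := residue_map_inj (r := r) haar_mu cf mp.
pose P k :=
  [exists q : 'I_(2 ^ r), (val q == k) && fconnect (@residue_map f r) m q].
have PE x : P (trunc r x) = fconnect (@residue_map f r) m (residue r x).
  apply/existsP/idP => [[q /andP[/eqP qx]]|mx]; last first.
    by exists (residue r x); rewrite eqxx.
  by rewrite (_ : q = residue r x) //; apply: val_inj.
pose S : set Z2 := [set x | P (trunc r x)]%classic.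
have mS : measurable S by apply: measurable_residue.
have fS : (f @^-1` S = S)%classic.
  apply/seteqP; split=> x; rewrite /S /= !PE -residue_mapE //;
    by rewrite -same_fconnect1_r.
have residueK (q : 'I_(2 ^ r)) x : trunc r x == q -> residue r x = q.
  by move=> /eqP xq; apply: val_inj.
have mA j := @measurable_residue r (pred1 j).
have null_class (q : 'I_(2 ^ r)) T : measurable T ->
    ([set x : Z2 | trunc r x == q] `<=` T)%classic -> mu T = 0%E -> False.
  move=> mT qT T0; apply: (residue_class_neq0 haar_mu (ltn_ord q)).
  by apply: subset_measure0 qT T0 => //; apply: mA.
have [S0|S1] := erg S mS fS.
  case: (null_class m S) => // x /= /residueK xm.
  by rewrite /S /= PE xm connect0.
apply: contrapT => mp_n; apply: (null_class p (~` S)%classic).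
- exact: measurableC.
- by move=> x /= /residueK xp; rewrite /S /= PE xp.
- by rewrite probability_setC // S1 subee.
Qed.

(** The arithmetic content of ergodicity: everything that follows about the bit
    stream of an orbit [x] depends on this property alone. *)
Definition single_cycles (x : nat -> Z2) : Prop :=
  forall r p q, trunc r (x p) = trunc r (x q) <-> p = q %[mod 2 ^ r].

Lemma iter_eq_mod_order (T : finType) (g : T -> T) x p q : injective g ->
  iter p g x = iter q g x <-> p = q %[mod order g x].
Proof.
move=> inj_g; have mod_order i : iter i g x = iter (i %% order g x) g x.
  rewrite [in LHS](divn_eq i (order g x)) addnC iterD; congr (iter _ _ _).
  by elim: (i %/ _) => //= k IHk; rewrite mulSn iterD IHk iter_order.
rewrite (mod_order p) (mod_order q); split=> [eq_pq|-> //].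
have lt_mod i : i %% order g x < order g x by rewrite ltn_mod order_gt0.
by rewrite -(findex_iter (lt_mod p)) eq_pq findex_iter.
Qed.

Lemma ergodic_single_cycles (R : realType) (mu : probability Z2 R) f z :
  is_haar mu -> compatible f -> ergodic mu f ->
  single_cycles (fun i => iter i f z).
Proof.
move=> haar_mu cf erg r p q.
have inj_f := residue_map_inj (r := r) haar_mu cf erg.1.
have iterE i : residue r (iter i f z) = iter i (@residue_map f r) (residue r z).
  by elim: i => //= i <-; rewrite residue_mapE.
have order_z : order (@residue_map f r) (residue r z) = 2 ^ r.
  rewrite /order -[RHS]card_ord; apply: eq_card => m.
  by rewrite inE; apply: residue_map_connect haar_mu cf erg _ _.
rewrite -[in X in _ <-> X]order_z -iter_eq_mod_order // -!iterE.
by split=> [eq_pq|/(congr1 val)//]; apply: val_inj.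
Qed.

(** * Windows of the bit stream *)

Definition bit_stream n (x : nat -> Z2) m : bool := digit (x (m %/ n)) (m %% n).

Lemma binary_repr_orbit f z n m : 0 < n ->
  binary_repr n (orbit_mod f z n) m = bit_stream n (fun i => iter i f z) m.
Proof. by move=> n_gt0; rewrite /binary_repr /orbit_mod bit_trunc ?ltn_mod. Qed.

Lemma bit_stream_block n x p i : i < n ->
  bit_stream n x (p * n + i) = digit (x p) i.
Proof.
move=> lt_in; have n_gt0 : 0 < n by apply: leq_ltn_trans lt_in.
by rewrite /bit_stream divnMDl // divn_small // addn0 modnMDl modn_small.
Qed.

(** A window of length [n] at offset [s] consists of the high bits of [x p] and
    the low [s] bits of [x p.+1]; the latter determine [p] modulo [2 ^ s], hence
    also the low [s] bits of [x p]. *)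
Lemma window_inj n x p q s : single_cycles x -> s < n ->
  (forall i, i < n ->
     bit_stream n x (p * n + s + i) = bit_stream n x (q * n + s + i)) ->
  p = q %[mod 2 ^ n].
Proof.
move=> cx lt_sn eq_pq; apply/cx/trunc_eqP => i lt_in.
have [le_si|lt_is] := leqP s i.
  have := eq_pq (i - s) (leq_ltn_trans (leq_subr _ _) lt_in).
  by rewrite -!addnA subnKC // !bit_stream_block.
suff /trunc_eqP eq_s : trunc s (x p) = trunc s (x q) by apply: eq_s.
have /cx/eqP : trunc s (x p.+1) = trunc s (x q.+1).
  apply/trunc_eqP => j lt_js; have lt_jn := ltn_trans lt_js lt_sn.
  (* Bit [j] of the next block is letter [n - s + j] of the window. *)
  have lt_i : n - s + j < n by rewrite -ltn_subRL subKn // ltnW.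
  have := eq_pq _ lt_i; rewrite !addnA -![_ + s + (n - s)]addnA.
  by rewrite !subnKC ?(ltnW lt_sn) // -![_ * n + n]mulSnr !bit_stream_block.
by rewrite -(addn1 p) -(addn1 q) eqn_modDr => /eqP/cx.
Qed.

(** The bit [s > 0] of a cyclic sequence cannot have period 2 in time: with the
    lower bits, it would then have period [2 ^ s] modulo [2 ^ s.+1]. *)
Lemma high_bit_not_2periodic x s a : single_cycles x -> 0 < s ->
  (forall q, digit (x (q.+2 + a)) s = digit (x (q + a)) s) -> False.
Proof.
move=> cx s_gt0 per2.
have per_even i : digit (x (i.*2 + a)) s = digit (x a) s.
  by elim: i => // i <-; rewrite doubleS per2.
have /cx/eqP : trunc s.+1 (x (2 ^ s + a)) = trunc s.+1 (x a).
  rewrite !truncS (_ : 2 ^ s = (2 ^ s.-1).*2); last first.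
    by rewrite -mul2n -expnS prednK.
  rewrite per_even (_ : trunc s _ = trunc s (x a)) //.
  by apply/cx; rewrite -mul2n -expnS prednK // modnDl.
rewrite -[X in _ == X %[mod _]]add0n eqn_modDr mod0n modn_small ?ltn_exp2l //.
by rewrite expn_eq0.
Qed.

(** A period [a * n + s] with [s > 0] would identify bit [0], which has period
    2 in time, with bit [s], which has not; when [s = 0] it is a period of the
    sequence of residues. *)
Lemma exact_period_bit_stream n x : single_cycles x -> 0 < n ->
  exact_period (bit_stream n x) (n * 2 ^ n).
Proof.
move=> cx n_gt0; split; first split=> [|m].
- by rewrite muln_gt0 n_gt0 expn_gt0.
- rewrite (divn_eq m n) addnAC (mulnC n) -mulnDl !bit_stream_block ?ltn_mod //.
  have /trunc_eqP := (cx n (2 ^ n + m %/ n) (m %/ n)).2 (modnDl _ _).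
  by rewrite addnC; apply; rewrite ltn_mod.
move=> p [p_gt0 per]; set s := p %% n; set a := p %/ n.
have def_p : p = a * n + s by apply: divn_eq.
have lt_sn : s < n by rewrite ltn_mod.
have [s0|s_gt0] := posnP s; last first.
  have low q : digit (x (q + a)) s = digit (x q) 0.
    rewrite -(bit_stream_block x q n_gt0) -per def_p addn0 addnA -mulnDl.
    by rewrite bit_stream_block.
  case: (@high_bit_not_2periodic x s a cx s_gt0) => q; rewrite !low.
  have /trunc_eqP : trunc 1 (x q.+2) = trunc 1 (x q).
    by apply/cx; rewrite -addn2 modnDr.
  by apply.
have a_gt0 : 0 < a by move: p_gt0; rewrite def_p s0; case: (a).
rewrite def_p s0 addn0 mulnC leq_pmul2r // dvdn_leq //.
have /cx/eqP : trunc n (x a) = trunc n (x 0).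
  apply/trunc_eqP => i lt_in.
  rewrite -(bit_stream_block x 0 lt_in) -per def_p s0 addn0.
  by rewrite mul0n add0n addnC bit_stream_block.
by rewrite mod0n.
Qed.

(** * Counting occurrences *)

Definition window (n : nat) (s : nat -> bool) (j : nat) : {ffun 'I_n -> bool} :=
  [ffun i : 'I_n => s (j + i)].

(** The pair of a position's offset modulo [n] and its window determines the
    position, by [window_inj]; there are as many pairs as positions, so every
    window occurs once at every offset. *)
Lemma card_window n x (A : {pred {ffun 'I_n -> bool}}) :
  single_cycles x -> 0 < n ->
  #|[pred j : 'I_(n * 2 ^ n) | window n (bit_stream n x) j \in A]| = n * #|A|.
Proof.
move=> cx n_gt0.
pose phi (j : 'I_(n * 2 ^ n)) : 'I_n * {ffun 'I_n -> bool} :=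
  (Ordinal (ltn_pmod j n_gt0), window n (bit_stream n x) j).
have inj_phi : injective phi.
  move=> j k [eq_mod /ffunP eq_w]; apply: val_inj => /=.
  have div_lt (i : 'I_(n * 2 ^ n)) : i %/ n < 2 ^ n.
    by rewrite ltn_divLR // [ltnRHS]mulnC.
  suff: j %/ n = k %/ n %[mod 2 ^ n].
    rewrite !modn_small // => eq_div.
    by rewrite (divn_eq j n) (divn_eq k n) eq_mod eq_div.
  apply: (@window_inj n x _ _ (j %% n)); rewrite ?ltn_mod // => i lt_in.
  by rewrite {2}eq_mod -!divn_eq; have := eq_w (Ordinal lt_in); rewrite !ffunE.
have bij_phi : bijective phi.
  by apply: inj_card_bij => //; rewrite card_prod card_ffun card_bool !card_ord.
transitivity #|[predX 'I_n & A]|; last by rewrite cardX card_ord.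
by rewrite -(on_card_preimset (onW_bij _ bij_phi)); apply: eq_card => j; rewrite !inE.
Qed.

Lemma card_prefix n k (b : nat -> bool) : k <= n ->
  #|[pred w : {ffun 'I_n -> bool} | [forall i : 'I_n, (i < k) ==> (w i == b i)]]|
  = 2 ^ (n - k).
Proof.
move=> le_kn.
pose F (i : 'I_n) : pred bool := if i < k then pred1 (b i) else predT.
transitivity #|(family F : simpl_pred {ffun 'I_n -> bool})|.
  apply: eq_card => w; apply/forallP/familyP => Fw i; move: (Fw i);
    by rewrite /F; case: (i < k).
rewrite card_family foldrE big_image /=.
rewrite (eq_bigr (fun i : 'I_n => if i < k then 1 else 2)) => [|i _]; last first.
  by rewrite /F; case: (i < k); rewrite ?card1 ?card_bool.
rewrite -(big_mkord predT (fun i => if i < k then 1 else 2)).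
rewrite (big_cat_nat (n := k)) //= big_nat_cond big1 ?mul1n; last first.
  by move=> i /andP[/andP[_ ->]].
rewrite big_nat_cond (eq_bigr (fun=> 2)) => [|i /andP[/andP[le_ki _] _]]; last first.
  by rewrite ltnNge le_ki.
by rewrite -big_nat_cond prod_nat_const_nat.
Qed.

Lemma eq_card_ord m m' (P Q : pred nat) :
  m = m' -> (forall j, j < m' -> P j = Q j) ->
  #|[pred j : 'I_m | P j]| = #|[pred j : 'I_m' | Q j]|.
Proof. by move=> -> eqPQ; apply: eq_card => j; apply: eqPQ. Qed.

Lemma card_ord_tail N k : #|[pred j : 'I_N | N < j + k]| <= k.
Proof.
rewrite -sum1_card big_mkcond /=.
rewrite -(big_mkord predT (fun j => if N < j + k then 1 else 0)).
rewrite (big_cat_nat (n := N - k)) ?leq_subr //= big_nat_cond big1 => [|i]; last first.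
  by rewrite andbT ltn_subRL addnC => /ltnW; rewrite leqNgt; case: ifP.
rewrite add0n (leq_trans (n := \sum_(N - k <= j < N) 1)) //.
  by apply: leq_sum => i _; case: ifP.
by rewrite sum_nat_const_nat muln1 leq_subLR addnC -leq_subLR.
Qed.

Definition occurs (s : nat -> bool) k (b : k.-tuple bool) (j : nat) : bool :=
  [forall i : 'I_k, tnth b i == s (j + i)].

Lemma cyc_occ_mkseq s N k (b : k.-tuple bool) : pure_period s N ->
  cyc_occ (mkseq s N) b = #|[pred j : 'I_N | occurs s b j]|.
Proof.
move=> [N_gt0 per].
have smod m : s (m %% N) = s m.
  rewrite {2}(divn_eq m N); elim: (m %/ N) => // d IHd.
  by rewrite mulSnr addnAC per.
apply: (@eq_card_ord _ _ (fun j => [forall i : 'I_k, tnth b i ==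
    nth false (mkseq s N) ((i + j) %% size (mkseq s N))])).
  by rewrite size_mkseq.
move=> j _; apply: eq_forallb => i.
by rewrite size_mkseq nth_mkseq ?ltn_mod // smod addnC.
Qed.

Lemma word_occ_mkseq s N k (b : k.-tuple bool) :
  word_occ (mkseq s N) b
  = #|[pred j : 'I_N | (j + k <= N) && occurs s b j]|.
Proof.
apply: (@eq_card_ord _ _ (fun j => (j + k <= size (mkseq s N)) &&
    [forall i : 'I_k, tnth b i == nth false (mkseq s N) (j + i)])
  (fun j => (j + k <= N) && occurs s b j)).
  by rewrite size_mkseq.
move=> j _; rewrite size_mkseq; case le_jk : (j + k <= N) => //=.
apply: eq_forallb => i; rewrite nth_mkseq //.
by rewrite (leq_trans _ le_jk) // ltn_add2l.
Qed.

(** Only the positions within [k] of the end of the word are lost when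
    occurrences may not wrap around. *)
Lemma word_occ_bounds s N k (b : k.-tuple bool) :
  word_occ (mkseq s N) b <= #|[pred j : 'I_N | occurs s b j]|
    <= word_occ (mkseq s N) b + k.
Proof.
rewrite word_occ_mkseq; apply/andP; split.
  by apply/subset_leq_card/fintype.subsetP => j; rewrite !inE => /andP[].
rewrite -(cardID [pred j : 'I_N | j + k <= N] [pred j : 'I_N | occurs s b j]).
apply: leq_add; first by apply: eq_leq; apply: eq_card => j; rewrite !inE andbC.
apply: leq_trans (card_ord_tail N k); apply/subset_leq_card/fintype.subsetP => j.
by rewrite !inE -ltnNge => /andP[].
Qed.

Lemma card_occurs_short n x k (b : k.-tuple bool) :
  single_cycles x -> 0 < n -> k <= n ->
  #|[pred j : 'I_(n * 2 ^ n) | occurs (bit_stream n x) b j]| = n * 2 ^ (n - k).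
Proof.
move=> cx n_gt0 le_kn; rewrite -(card_prefix (nth false b) le_kn).
rewrite -(card_window _ cx n_gt0); apply: eq_card => j; rewrite !inE.
apply/forallP/forallP => /= [occ i|occ i].
  apply/implyP => lt_ik; rewrite ffunE eq_sym.
  by have := occ (Ordinal lt_ik); rewrite (tnth_nth false).
have := occ (widen_ord le_kn i).
by rewrite /= ltn_ord ffunE eq_sym (tnth_nth false).
Qed.

Lemma card_occurs_long n x k (b : k.-tuple bool) :
  single_cycles x -> 0 < n -> n <= k ->
  #|[pred j : 'I_(n * 2 ^ n) | occurs (bit_stream n x) b j]| <= n.
Proof.
move=> cx n_gt0 le_nk.
pose w : {ffun 'I_n -> bool} := [ffun i : 'I_n => nth false b i].
have := card_window (pred1 w) cx n_gt0; rewrite card1 muln1 => /eq_leq.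
apply: leq_trans; apply/subset_leq_card/fintype.subsetP => j; rewrite !inE => /forallP occ.
apply/eqP/ffunP => i; rewrite !ffunE.
by have /eqP := occ (widen_ord le_nk i); rewrite (tnth_nth false).
Qed.

(** * Strict distribution and the frequency estimate *)

Lemma k_full_bit_stream n x : single_cycles x -> 0 < n ->
  k_full (mkseq (bit_stream n x) (n * 2 ^ n)) n.
Proof.
move=> cx n_gt0; have [per _] := exact_period_bit_stream cx n_gt0.
split; first by rewrite size_mkseq ltn_Pmulr // -{1}(expn0 2) ltn_exp2l.
exists n => // b; rewrite cyc_occ_mkseq // card_occurs_short //.
by rewrite subnn muln1.
Qed.

Lemma inv_exp2_le_inv_sqrt (R : realType) n : 0 < n ->
  ((2 ^+ n)^-1 <= 1 / Num.sqrt (n * 2 ^ n)%:R :> R)%R.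
Proof.
move=> n_gt0; rewrite div1r lef_pV2 ?posrE ?exprn_gt0 //; last first.
  by rewrite sqrtr_gt0 ltr0n muln_gt0 n_gt0 expn_gt0.
rewrite -[leRHS]ger0_norm ?exprn_ge0 // -sqrtr_sqr ler_wsqrtr //.
by rewrite -natrX -natrX ler_nat -mulnn leq_pmul2r ?expn_gt0 // ltnW // ltn_expl.
Qed.

(** Words of length [k <= n] miss their exact cyclic frequency [1 / 2 ^ k] by at
    most [k] positions; longer words have at most [n] occurrences while
    [1 / 2 ^ k] is below [1 / 2 ^ n]. Either way the deviation is at most
    [n / (n * 2 ^ n)]. *)
Lemma word_frequency (R : realType) n x k (b : k.-tuple bool) :
  single_cycles x -> 0 < n ->
  (`| (word_occ (mkseq (bit_stream n x) (n * 2 ^ n)) b)%:R / (n * 2 ^ n)%:R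
      - 1 / 2 ^+ k | <= (2 ^+ n)^-1 :> R)%R.
Proof.
move=> cx n_gt0; have := word_occ_bounds (bit_stream n x) (n * 2 ^ n) b.
set v := word_occ _ _ => /andP[le_vC le_Cv].
have n_neq0 : (n%:R != 0 :> R)%R by rewrite pnatr_eq0 -lt0n.
have N_gt0 : (0 < (n * 2 ^ n)%:R :> R)%R.
  by rewrite ltr0n muln_gt0 n_gt0 expn_gt0.
have nN : (n%:R / (n * 2 ^ n)%:R = (2 ^+ n)^-1 :> R)%R.
  by rewrite natrM natrX invfM mulrA divff // mul1r.
rewrite -nN; have [le_kn|lt_nk] := leqP k n.
  have CN : ((n * 2 ^ (n - k))%:R / (n * 2 ^ n)%:R = 1 / 2 ^+ k :> R)%R.
    have -> : 2 ^ n = 2 ^ (n - k) * 2 ^ k by rewrite -expnD subnK.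
    rewrite mulnA [X in (_ / X)%R]natrM invfM mulrA divff ?mul1r ?natrX //.
    by rewrite natrM natrX mulf_neq0 // expf_neq0 // pnatr_eq0.
  rewrite -CN -mulrBl normrM [X in (_ * X)%R]ger0_norm ?invr_ge0 ?ler0n //.
  rewrite ler_pM2r ?invr_gt0 //.
  move: le_vC le_Cv; rewrite card_occurs_short // => le_vC le_Cv.
  rewrite distrC ger0_norm ?subr_ge0 ?ler_nat // lerBlDl -natrD ler_nat.
  by rewrite (leq_trans le_Cv) // leq_add2l.
have le_vn : v <= n.
  exact: leq_trans le_vC (card_occurs_long b cx n_gt0 (ltnW lt_nk)).
have le_vN : (0 <= (v%:R : R) / (n * 2 ^ n)%:R <= n%:R / (n * 2 ^ n)%:R)%R.
  by rewrite divr_ge0 ?ler0n //= ler_pM2r ?invr_gt0 // ler_nat.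
have le_kN : (0 <= (1 : R) / 2 ^+ k <= n%:R / (n * 2 ^ n)%:R)%R.
  rewrite nN div1r invr_ge0 exprn_ge0 //= lef_pV2 ?posrE ?exprn_gt0 //.
  by rewrite ler_weXn2l ?ler1n // ltnW.
case/andP: le_vN => v0 vN; case/andP: le_kN => k0 kN.
rewrite ler_norml lerBlDr (le_trans vN) ?lerDl // andbT.
by rewrite lerBrDr (le_trans _ v0) // addrC subr_le0.
Qed.

Theorem theorem6p1 (R : realType) (mu : probability Z2 R) (f : Z2 -> Z2)
    (z : Z2) (n : nat) :
  is_haar mu -> compatible f -> ergodic mu f -> (1 <= n)%N ->
  let T' := binary_repr n (orbit_mod f z n) in
  [/\ exact_period T' (n * 2 ^ n)%N, strictly_distributed n T' & Q1 R T'].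
Proof.
move=> haar_mu cf erg n_gt0 T'.
have cx := ergodic_single_cycles z haar_mu cf erg.
have -> : T' = bit_stream n (fun i => iter i f z).
  by apply/funext => m; apply: binary_repr_orbit.
have per := exact_period_bit_stream cx n_gt0.
split=> //; exists (n * 2 ^ n) => //; first exact: k_full_bit_stream.
move=> k b _ _; rewrite size_mkseq.
exact: le_trans (word_frequency R b cx n_gt0) (inv_exp2_le_inv_sqrt R n_gt0).
Qed.
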